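(* Let $\varepsilon\in(0,\tfrac12)$ be constant and let $k=k(n)$ satisfy $(2+\varepsilon)\log_2 n\le k\le n^{1/2-\varepsilon}$. If the (quantum) strong search planted-clique conjecture holds, then for every inverse polynomial $\delta=\delta(n)$ no efficient algorithm, given $G$ and $k$, outputs, with probability $\ge\delta$ over $G\sim G(n,\tfrac12,k)$ (and its internal randomness), a single $(k-2)$-simplex of $X(G)$.
   Context: Graphs are simple graphs on $[n]=\{1,\dots,n\}$. $G(n,\tfrac12)$ is the Erdős–Rényi distribution (each edge present independently with probability $\tfrac12$). $G(n,\tfrac12,k)$ is obtained by drawing $G_0\sim G(n,\tfrac12)$, choosing a uniformly random $k$-subset $S\subseteq[n]$ and adding every edge inside $S$. The clique complex $X(G)$ is the simplicial complex whose $d$-simplices are the $(d+1)$-cliques of $G$. An efficient algorithm is a randomized or quantum algorithm running in time $\mathrm{poly}(n)$. ''No algorithm achieves probability at least $q(n)$'' means that no algorithm achieves this for all sufficiently large $n$. Strong search planted-clique conjecture (quantum version): for all constants $\varepsilon>0$, $\alpha\in(0,\tfrac12)$ and $c>0$, every quantum polynomial-time algorithm fails to find a $k$-clique in $G\sim G(n,\tfrac12,k)$ with probability at least $1-n^{-c}$ (i.e. succeeds with probability at most $n^{-c}$), for all sufficiently large $n$ and all $k$ with $(2+\varepsilon)\log_2 n\le k\le n^{1/2-\alpha}$. *)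

(* Defs.v *)
From mathcomp Require Import all_boot all_order all_algebra.
From mathcomp Require Import all_classical all_reals all_analysis.
From mathcomp Require Import complex.

Set Implicit Arguments.
Unset Strict Implicit.
Unset Printing Implicit Defensive.

Import Order.TTheory GRing.Theory Num.Theory.
Local Open Scope ring_scope.

Definition simple_edges (n : nat) (E : {set {set 'I_n}}) : bool :=
  [forall e in E, #|e| == 2].

Definition graph (n : nat) : finType := {E : {set {set 'I_n}} | simple_edges E}.

Definition edges n (G : graph n) : {set {set 'I_n}} := sval G.

Definition adj n (G : graph n) (i j : 'I_n) : bool := [set i; j] \in edges G.

Definition clique n (G : graph n) (A : {set 'I_n}) : bool :=
  [forall i in A, forall j in A, (i != j) ==> adj G i j].

(* An abstract simplicial complex is given by its set of nonempty faces. *)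
Definition clique_complex n (G : graph n) : {set {set 'I_n}} :=
  [set A | (A != finset.set0) && clique G A].

Definition simplex n (X : {set {set 'I_n}}) (d : nat) (A : {set 'I_n}) : bool :=
  (A \in X) && (#|A| == d.+1).

Definition pairs_in n (S : {set 'I_n}) : {set {set 'I_n}} :=
  [set e : {set 'I_n} | (#|e| == 2) && (e \subset S)].

Lemma plant_simple n (G : graph n) (S : {set 'I_n}) :
  simple_edges (edges G :|: pairs_in S).
Proof.
apply/'forall_implyP => e; rewrite !inE => /orP[eG|/andP[]//].
by have /'forall_implyP := valP G; apply.
Qed.

Definition plant n (G : graph n) (S : {set 'I_n}) : graph n :=
  exist _ (edges G :|: pairs_in S) (plant_simple G S).

Section RandomGraphs.
Variable R : realType.

(* G(n, p): every pair is an edge independently with probability p. *)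
Definition er_pmf n (p : R) (G : graph n) : R :=
  \prod_(e : {set 'I_n} | #|e| == 2) (if e \in edges G then p else 1 - p).

(* G(n, 1/2, k): law of [plant G0 S] for independent G0 ~ G(n, 1/2) and
   S uniform among the k-subsets. *)
Definition planted_pmf n (k : nat) (G : graph n) : R :=
  \sum_(S : {set 'I_n} | #|S| == k) \sum_(G0 : graph n | plant G0 S == G)
    ('C(n, k)%:R)^-1 * er_pmf 2^-1 G0.

End RandomGraphs.

(* Algorithms are programs of a while-language whose classical data are binary
   trees (Jones' WHILE language, whose polynomial time with unit-cost
   instructions is that of Turing machines), extended with fair coin flips and
   with instructions acting on a quantum register: allocation of a qubit in
   state |0>, the universal gate set {H, T, CNOT}, and measurement in the
   computational basis.  Randomized algorithms are the programs that use no
   quantum instruction. *)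
Inductive tree := Leaf | Node of tree & tree.

Definition is_leaf (t : tree) : bool := if t is Leaf then true else false.
Definition tleft (t : tree) : tree := if t is Node a _ then a else Leaf.
Definition tright (t : tree) : tree := if t is Node _ b then b else Leaf.

Definition tree_of_seq (s : seq tree) : tree := foldr Node Leaf s.
Fixpoint seq_of_tree (t : tree) : seq tree :=
  if t is Node a b then a :: seq_of_tree b else [::].

Definition tree_of_bool (b : bool) : tree := if b then Node Leaf Leaf else Leaf.

(* Numbers, including qubit addresses, are encoded in unary. *)
Definition tree_of_nat (m : nat) : tree := tree_of_seq (nseq m Leaf).
Definition nat_of_tree (t : tree) : nat := size (seq_of_tree t).

Inductive expr :=
  | Var of nat
  | ELeaf
  | ENode of expr & expr
  | ELeft of expr
  | ERight of expr.

Inductive cmd :=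
  | Assign of nat & expr
  | Seq of cmd & cmd
  | If of expr & cmd & cmd
  | While of expr & cmd
  | Flip of nat
  | NewQubit of nat
  | GateH of expr
  | GateT of expr
  | GateCNOT of expr & expr
  | MeasureQubit of nat & expr.

Definition store := nat -> tree.

Definition upd (s : store) (x : nat) (t : tree) : store :=
  fun y => if y == x then t else s y.

Fixpoint eval (s : store) (e : expr) : tree :=
  match e with
  | Var x => s x
  | ELeaf => Leaf
  | ENode a b => Node (eval s a) (eval s b)
  | ELeft a => tleft (eval s a)
  | ERight a => tright (eval s a)
  end.

Section Semantics.
Variable R : realType.

Notation C := (complex R).

Definition rsqrt2 : R := (Num.sqrt 2)^-1.
Definition omega8 : C := Complex rsqrt2 rsqrt2.

Definition sqmod (z : C) : R := complex.Re z ^+ 2 + complex.Im z ^+ 2.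

(* [amp b] is the amplitude of the basis state |b>; only the bit strings [b] of
   length [nqubits] are meaningful.  The vector is not normalized: its squared
   norm is the probability of the branch that led to it. *)
Record qstate := QState { nqubits : nat; amp : seq bool -> C }.

Definition bit (b : seq bool) (i : nat) : bool := nth false b i.
Definition set_bit (b : seq bool) (i : nat) (v : bool) : seq bool :=
  set_nth false b i v.

Definition sqnorm (q : qstate) : R :=
  \sum_(b : (nqubits q).-tuple bool) sqmod (amp q b).

Definition qinit : qstate := QState 0 (fun=> 1).

Definition qscale (a : C) (q : qstate) : qstate :=
  QState (nqubits q) (fun b => a * amp q b).

Definition qnew (q : qstate) : qstate :=
  QState (nqubits q).+1
    (fun b => if bit b (nqubits q) then 0 else amp q (take (nqubits q) b)).

(* Gates at an address outside the register, and CNOT with equal control and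
   target, do nothing. *)
Definition qH (i : nat) (q : qstate) : qstate :=
  if (i < nqubits q)%N then
    QState (nqubits q) (fun b => Complex rsqrt2 0 *
      (amp q (set_bit b i false) + (-1) ^+ bit b i * amp q (set_bit b i true)))
  else q.

Definition qT (i : nat) (q : qstate) : qstate :=
  if (i < nqubits q)%N then
    QState (nqubits q) (fun b => (if bit b i then omega8 else 1) * amp q b)
  else q.

Definition qCNOT (i j : nat) (q : qstate) : qstate :=
  if [&& i < nqubits q, j < nqubits q & i != j]%N then
    QState (nqubits q) (fun b => amp q (set_bit b j (bit b j (+) bit b i)))
  else q.

(* Projection onto "qubit i has value v".  A nonexistent qubit reads as 0. *)
Definition qproj (i : nat) (v : bool) (q : qstate) : qstate :=
  QState (nqubits q) (fun b => if bit b i == v then amp q b else 0).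

Definition config : Type := store * qstate.

Definition join_branches (L0 L1 : option (seq config)) : option (seq config) :=
  if L0 is Some l0 then if L1 is Some l1 then Some (l0 ++ l1) else None
  else None.

(* [run t ks (s, q)] executes the commands [ks] in sequence, every elementary
   instruction or test costing one unit of time.  It is [Some L] when every
   computation path (over coin flips and measurement outcomes) halts within [t]
   steps, [L] listing the final configurations of these paths, and [None]
   otherwise. *)
Fixpoint run (t : nat) (ks : seq cmd) (c : config) : option (seq config) :=
  if ks is k :: ks' then
    if t is t'.+1 then
      let: (s, q) := c in
      match k with
      | Assign x e => run t' ks' (upd s x (eval s e), q)
      | Seq k1 k2 => run t' [:: k1, k2 & ks'] c
      | If e k1 k2 => run t' ((if is_leaf (eval s e) then k2 else k1) :: ks') c
      | While e k1 =>
          if is_leaf (eval s e) then run t' ks' c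
          else run t' [:: k1, While e k1 & ks'] c
      | Flip x =>
          let q' := qscale (Complex rsqrt2 0) q in
          join_branches (run t' ks' (upd s x (tree_of_bool false), q'))
                        (run t' ks' (upd s x (tree_of_bool true), q'))
      | NewQubit x => run t' ks' (upd s x (tree_of_nat (nqubits q)), qnew q)
      | GateH e => run t' ks' (s, qH (nat_of_tree (eval s e)) q)
      | GateT e => run t' ks' (s, qT (nat_of_tree (eval s e)) q)
      | GateCNOT e f =>
          run t' ks'
            (s, qCNOT (nat_of_tree (eval s e)) (nat_of_tree (eval s f)) q)
      | MeasureQubit x e =>
          let i := nat_of_tree (eval s e) in
          join_branches
            (run t' ks' (upd s x (tree_of_bool false), qproj i false q))
            (run t' ks' (upd s x (tree_of_bool true), qproj i true q))
      end
    else None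
  else Some [:: c].

(* The input (G, k): variable 0 holds the adjacency matrix of G (a list of
   lists of bits), variable 1 holds k. *)
Definition input_store n (G : graph n) (k : nat) : store := fun x =>
  match x with
  | 0 => tree_of_seq
           [seq tree_of_seq [seq tree_of_bool (adj G i j) | j <- enum 'I_n]
           | i <- enum 'I_n]
  | 1 => tree_of_nat k
  | _ => Leaf
  end.

(* The output vertex set is given by its characteristic vector, read in
   variable 0. *)
Definition output_set n (s : store) : {set 'I_n} :=
  [set i : 'I_n | ~~ is_leaf (nth Leaf (seq_of_tree (s 0)) i)].

Definition time_bound (d n : nat) : nat := (n ^ d + d)%N.

Definition exec (P : cmd) (t : nat) n (G : graph n) (k : nat) :
    option (seq config) :=
  run t [:: P] (input_store G k, qinit).

Record efficient_algorithm := EfficientAlgorithm {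
  program : cmd;
  degree : nat;
  halts_in_poly_time : forall n (G : graph n) (k : nat), (k <= n)%N ->
    isSome (exec program (time_bound degree n) G k) }.

Definition output_prob (A : efficient_algorithm) n (G : graph n) (k : nat)
    (Q : pred {set 'I_n}) : R :=
  if exec (program A) (time_bound (degree A) n) G k is Some L then
    \sum_(c <- L | Q (output_set n c.1)) sqnorm c.2
  else 0.

(* Probability, over G ~ G(n, 1/2, k) and the internal randomness of A, that
   A (G, k) outputs a set satisfying [Q G]. *)
Definition success_prob (A : efficient_algorithm) (n k : nat)
    (Q : graph n -> pred {set 'I_n}) : R :=
  \sum_(G : graph n) planted_pmf R k G * output_prob A G k (Q G).

Definition log2 (x : R) : R := ln x / ln 2.

Local Open Scope classical_set_scope.

Definition strong_search_planted_clique_conjecture : Prop :=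
  forall eps alpha c : R, 0 < eps -> 0 < alpha < 2^-1 -> 0 < c ->
  forall A : efficient_algorithm,
  \forall n \near \oo, forall k : nat,
    (2 + eps) * log2 n%:R <= k%:R <= n%:R `^ (2^-1 - alpha) ->
    success_prob A k (fun (G : graph n) S => clique G S && (#|S| == k))
      <= n%:R `^ (- c).

(* delta(n) >= n^{-O(1)} *)
Definition inverse_polynomial (delta : nat -> R) : Prop :=
  exists c : nat, \forall n \near \oo, n%:R ^- c <= delta n.

End Semantics.

(* Main.v *)
Require Import Defs.
From mathcomp Require Import all_boot all_order all_algebra.
From mathcomp Require Import all_classical all_reals all_analysis.
From mathcomp Require Import complex ring lra zify.

(* A (k-1)-clique K found by A with probability >= n^-c has j vertices outside
   the planted clique S.  The expected number of (k-1)-cliques with j >= J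
   vertices outside S is at most n^-(c+1) once the constant J is large, so with
   probability >= n^-c / 2 the output differs from S in at most 2 J vertices.
   The algorithm that runs A and then 2 J times sets the membership of a random
   vertex to a random bit therefore outputs S with probability n^-O(1), against
   the conjecture.  (Only looking for a vertex that extends K is not enough: a
   clique K with j > 0 exists with probability n^-O(1), which need not be
   negligible compared to the success probability of A.) *)

Set Implicit Arguments.
Unset Strict Implicit.
Unset Printing Implicit Defensive.

Import Order.TTheory GRing.Theory Num.Theory.
Local Open Scope ring_scope.

(** * Conservation of the norm *)

(** A constant [J] suffices because every vertex outside the planted clique multiplies the expected
    number of cliques by at most about [2 n / 2^(k/2)], which is at most [2 n^(-eps/2)] for
    [k >= (2 + eps) log2 n]; the choices inside the planted clique are paid for by the remaining
    forced edges. Hence [J] of order [h / eps] gains [n^(-h)], while guessing [2 J] corrections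
    costs only the polynomial factor [(4 n)^(2 J)]. The obstacle that shapes the first half is the
    concrete machine model: the new algorithm must be an explicit program all of whose paths halt in
    polynomial time, and its only classical randomness is a fair coin. A uniform vertex is therefore
    out of reach for general [n]; repeatedly keeping a random half of a candidate list gives each
    vertex probability at least [2^(-r)] whenever [n <= 2^r], and such a lower bound is all that is
    needed. The mutations run after a quantum program, so their analysis must hold for an arbitrary
    unnormalized register. *)

Section Norm.
Variable R : realType.
Implicit Types (q : qstate R) (z w : complex R).

Lemma sqmod_ge0 z : 0 <= sqmod z.
Proof. by rewrite addr_ge0 ?sqr_ge0. Qed.

Lemma sqnorm_ge0 q : 0 <= sqnorm q.
Proof. by apply: sumr_ge0 => b _; apply: sqmod_ge0. Qed.

Lemma sqmodM z w : sqmod (z * w) = sqmod z * sqmod w.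
Proof. by case: z w => [a b] [c d]; rewrite /sqmod /=; ring. Qed.

Lemma rsqrt2_sq : rsqrt2 R ^+ 2 = 2^-1.
Proof. by rewrite /rsqrt2 exprVn sqr_sqrtr. Qed.

Lemma sqmod_rsqrt2 : sqmod (Complex (rsqrt2 R) 0) = 2^-1.
Proof. by rewrite /sqmod /= rsqrt2_sq expr0n addr0. Qed.

Lemma sqmod_omega8 : sqmod (omega8 R) = 1.
Proof. by rewrite /sqmod /= rsqrt2_sq; lra. Qed.

Lemma sqmod0 : sqmod (0 : complex R) = 0.
Proof. by rewrite /sqmod /= expr0n addr0. Qed.

Lemma sqmod1 : sqmod (1 : complex R) = 1.
Proof. by rewrite /sqmod /= expr0n expr1n addr0. Qed.

Lemma sqmod_parallelogram z w :
  sqmod (z + w) + sqmod (z - w) = 2 * (sqmod z + sqmod w).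
Proof. by case: z w => [a b] [c d]; rewrite /sqmod /=; ring. Qed.

Lemma sqnorm_qscale a q : sqnorm (qscale a q) = sqmod a * sqnorm q.
Proof. by rewrite /sqnorm mulr_sumr; apply: eq_bigr => b _; rewrite sqmodM. Qed.

Lemma sqnorm_qinit : sqnorm (qinit R) = 1.
Proof.
rewrite /sqnorm (eq_bigr (fun=> 1)) => [|b _]; last exact: sqmod1.
by rewrite sumr_const card_tuple expn0.
Qed.

(** [set_bit] lengthens a list when [i] is out of range; the default [b] keeps the length [n], so
    that sums over basis states can be reindexed. *)
Definition write_bit n (b : n.-tuple bool) i v : n.-tuple bool :=
  insubd b (set_bit b i v).

Lemma val_write_bit n (b : n.-tuple bool) i v :
  (i < n)%N -> val (write_bit b i v) = set_bit b i v.
Proof.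
move=> lt_in; rewrite val_insubd size_set_nth size_tuple.
by rewrite (maxn_idPr lt_in) eqxx.
Qed.

Lemma bit_write_bit n (b : n.-tuple bool) i v j :
  (i < n)%N -> bit (write_bit b i v) j = if j == i then v else bit b j.
Proof. by move=> lt_in; rewrite /bit val_write_bit // nth_set_nth /=. Qed.

Lemma eq_tuple_bit n (b c : n.-tuple bool) : bit b =1 bit c -> b = c.
Proof.
move=> eq_bc; apply/val_inj/(@eq_from_nth _ false).
  by rewrite !size_tuple.
by move=> i _; apply: eq_bc.
Qed.

(** Basis states whose new bit is 1 have amplitude 0; the others correspond to the old ones by
    appending a 0. *)
Lemma sqnorm_qnew q : sqnorm (qnew q) = sqnorm q.
Proof.
rewrite /sqnorm /=; set n := nqubits q.
rewrite (bigID (fun b : n.+1.-tuple bool => bit b n)) /=.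
rewrite big1 ?add0r => [|b ->]; last exact: sqmod0.
pose ext (b : n.-tuple bool) : n.+1.-tuple bool := [tuple of rcons b false].
pose cut (b : n.+1.-tuple bool) : n.-tuple bool := insubd (nseq_tuple n false) (take n b).
have val_cut b : val (cut b) = take n b.
  by rewrite val_insubd size_takel ?size_tuple ?eqxx.
rewrite (reindex_onto ext cut) => [|b nb]; last first.
  apply: eq_tuple_bit => i; rewrite /bit /= val_cut nth_rcons size_takel ?size_tuple //.
  case: ltngtP => [lt_in|gt_in|->]; first by rewrite nth_take.
    by rewrite nth_default ?size_tuple.
  by apply/esym/negbTE.
apply: eq_big => [b|b].
  rewrite /bit /= nth_rcons size_tuple ltnn eqxx /=; apply/eqP/val_inj.
  by rewrite val_cut /= -cats1 takel_cat ?size_tuple // take_oversize ?size_tuple.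
move=> /andP[/negbTE -> _]; congr (sqmod (amp q _)).
by rewrite /= -cats1 takel_cat ?size_tuple // take_oversize ?size_tuple.
Qed.

Lemma sqnorm_qT i q : sqnorm (qT i q) = sqnorm q.
Proof.
rewrite /qT; case: ifP => // _; apply: eq_bigr => b _ /=.
by rewrite sqmodM; case: ifP => _; rewrite ?sqmod_omega8 ?sqmod1 mul1r.
Qed.

Lemma sqnorm_qCNOT i j q : sqnorm (qCNOT i j q) = sqnorm q.
Proof.
rewrite /qCNOT; case: ifP => // /and3P[lt_i lt_j neq_ij].
pose cnot (b : (nqubits q).-tuple bool) := write_bit b j (bit b j (+) bit b i).
have cnotK : involutive cnot.
  move=> b; apply: eq_tuple_bit => l; rewrite !bit_write_bit // eqxx (negbTE neq_ij).
  by case: eqP => // ->; rewrite addbK.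
rewrite {2}/sqnorm (reindex_inj (inv_inj cnotK)); apply: eq_bigr => b _ /=.
by rewrite val_write_bit.
Qed.

Lemma sqnorm_qH i q : sqnorm (qH i q) = sqnorm q.
Proof.
rewrite /qH; case: ifP => // lt_i.
pose flip (b : (nqubits q).-tuple bool) := write_bit b i (~~ bit b i).
have flipK : involutive flip.
  move=> b; apply: eq_tuple_bit => l; rewrite !bit_write_bit // eqxx.
  by case: eqP => // ->; rewrite negbK.
(* Summing over [b] and [flip b] together counts every pair twice, so that the parallelogram law
   applies without choosing a representative of each pair. *)
have double (f : (nqubits q).-tuple bool -> R) :
    (\sum_b f b) * 2 = \sum_b (f b + f (flip b)).
  rewrite big_split /= [X in _ = _ + X](_ : _ = \sum_b f b); first by ring.
  by rewrite [RHS](reindex_inj (inv_inj flipK)).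
apply: (mulIf (x := 2)) => //; rewrite /sqnorm !double /=.
apply: eq_bigr => b _; rewrite bit_write_bit // eqxx.
have write_flip v : set_bit (flip b) i v = set_bit b i v.
  rewrite -!val_write_bit //; congr val; apply: eq_tuple_bit => l.
  by rewrite !bit_write_bit //; case: eqP.
rewrite !write_flip !sqmodM !sqmod_rsqrt2.
have amp_b : amp q b = amp q (set_bit b i (bit b i)).
  congr amp; rewrite -val_write_bit //; congr val; apply: eq_tuple_bit => l.
  by rewrite bit_write_bit //; case: eqP => // ->.
have amp_flip : amp q (flip b) = amp q (set_bit b i (~~ bit b i)).
  by rewrite /flip val_write_bit.
rewrite amp_b amp_flip -mulrDr.
set z := amp q (set_bit b i false); set w := amp q (set_bit b i true).
by case: (bit b i); rewrite /= ?expr1 ?expr0 mulN1r mul1r ?[sqmod (z - w) + _]addrC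
  sqmod_parallelogram mulrA mulVf // mul1r // addrC.
Qed.

Lemma sqnorm_qproj i q :
  sqnorm (qproj i false q) + sqnorm (qproj i true q) = sqnorm q.
Proof.
rewrite /sqnorm -big_split; apply: eq_bigr => b _ /=.
by case: (bit b i); rewrite /= sqmod0 ?add0r ?addr0.
Qed.

Lemma sqnorm_coin q :
  sqnorm (qscale (Complex (rsqrt2 R) 0) q) = 2^-1 * sqnorm q.
Proof. by rewrite sqnorm_qscale sqmod_rsqrt2. Qed.

(** Gates are unitary, and coins and measurements split the squared norm between their two branches.
    This bounds every output probability by 1, the only bound available on graphs with a clique far
    from the planted one. *)
Lemma run_sqnorm t ks (c : config R) L :
  run t ks c = Some L -> \sum_(c' <- L) sqnorm c'.2 = sqnorm c.2.
Proof.
elim: t ks c L => [|t IH] [|k ks] [s q] L //=.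
- by case=> <-; rewrite big_seq1.
- by case=> <-; rewrite big_seq1.
have branches r r' : join_branches r r' = Some L ->
    exists2 l, r = Some l & exists2 l', r' = Some l' & L = l ++ l'.
  by case: r r' => [l|] [l'|] //= [<-]; exists l => //; exists l'.
case: k => [x e|k1 k2|e k1 k2|e k|x|x|e|e|e f|x e].
- by move/IH.
- by move/IH.
- by move/IH.
- by case: ifP => _ /IH.
- case/branches=> l /IH l0 [l' /IH l1 ->]; rewrite big_cat /= l0 l1 /= !sqnorm_coin.
  by lra.
- by move/IH => -> /=; rewrite sqnorm_qnew.
- by move/IH => -> /=; rewrite sqnorm_qH.
- by move/IH => -> /=; rewrite sqnorm_qT.
- by move/IH => -> /=; rewrite sqnorm_qCNOT.
- case/branches=> l /IH l0 [l' /IH l1 ->]; rewrite big_cat /= l0 l1 /=.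
  exact: sqnorm_qproj.
Qed.

End Norm.

(** * Running programs *)

Lemma tree_of_seqK : cancel tree_of_seq seq_of_tree.
Proof. by elim=> //= a s ->. Qed.

Lemma seq_of_tright t : seq_of_tree (tright t) = behead (seq_of_tree t).
Proof. by case: t. Qed.

Lemma tleft_head t : tleft t = head Leaf (seq_of_tree t).
Proof. by case: t. Qed.

Lemma is_leafE t : is_leaf t = (size (seq_of_tree t) == 0)%N.
Proof. by case: t. Qed.

Fixpoint expr_bound (e : expr) : nat :=
  match e with
  | Var x => x.+1
  | ELeaf => 0
  | ENode a b => maxn (expr_bound a) (expr_bound b)
  | ELeft a | ERight a => expr_bound a
  end.

Fixpoint cmd_bound (k : cmd) : nat :=
  match k with
  | Assign x e | MeasureQubit x e => maxn x.+1 (expr_bound e)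
  | Seq k1 k2 => maxn (cmd_bound k1) (cmd_bound k2)
  | If e k1 k2 => maxn (expr_bound e) (maxn (cmd_bound k1) (cmd_bound k2))
  | While e k1 => maxn (expr_bound e) (cmd_bound k1)
  | Flip x | NewQubit x => x.+1
  | GateH e | GateT e => expr_bound e
  | GateCNOT e f => maxn (expr_bound e) (expr_bound f)
  end.

Lemma eval_upd s N v e : (expr_bound e <= N)%N -> Defs.eval (upd s N v) e = Defs.eval s e.
Proof.
elim: e => //= [x|a IHa b IHb|a IHa|a IHa].
- by rewrite /upd => lt_xN; rewrite ltn_eqF.
- by rewrite geq_max => /andP[/IHa -> /IHb ->].
- by move/IHa ->.
- by move/IHa ->.
Qed.

Lemma updC s x a N v :
  (x < N)%N -> upd (upd s N v) x a = upd (upd s x a) N v.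
Proof.
move=> lt_xN; apply: funext => y; rewrite /upd.
by case: (eqVneq y x) => // ->; rewrite ltn_eqF.
Qed.

Section Run.
Variable R : realType.
Implicit Types (q : qstate R) (c : config R) (s : store) (ks : seq cmd).

Lemma run_leq t t' ks c L :
  (t <= t')%N -> run t ks c = Some L -> run t' ks c = Some L.
Proof.
elim: t t' ks c L => [|t IH] [|t'] [|k ks] [s q] L //= le_t.
have mono_join r0 r1 r0' r1' :
    (forall l, r0 = Some l -> r0' = Some l) ->
    (forall l, r1 = Some l -> r1' = Some l) ->
    @join_branches R r0 r1 = Some L -> join_branches r0' r1' = Some L.
  case: r0 r1 => [l|] [l'|] // h0 h1 <-.
  by rewrite (h0 _ erefl) (h1 _ erefl).
case: k => [x e|k1 k2|e k1 k2|e k1|x|x|e|e|e f|x e];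
  try exact: IH; try by apply: mono_join => l; apply: IH.
by case: ifP => _; apply: IH.
Qed.

(** Frame property: variable [N] is neither read nor written, so a value saved there survives the
    run and does not influence it. *)
Lemma run_upd N v t ks s q :
  all (fun k => cmd_bound k <= N)%N ks ->
  run t ks (upd s N v, q) =
    omap (map (fun c => (upd c.1 N v, c.2))) (run t ks (s, q)).
Proof.
elim: t ks s q => [|t IH] [|k ks] s q //= /andP[kN ksN].
have join_map f r0 r1 :
    join_branches (omap (map f) r0) (omap (map f) r1) =
    omap (map f) (@join_branches R r0 r1).
  by case: r0 r1 => [l|] [l'|] //=; rewrite map_cat.
case: k kN => [x e|k1 k2|e k1 k2|e k1|x|x|e|e|e f|x e] /=;
  rewrite ?geq_max.
- by case/andP=> xN eN; rewrite eval_upd // updC // IH.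
- by case/andP=> k1N k2N; rewrite IH //= k1N k2N.
- by case/and3P=> eN k1N k2N; rewrite eval_upd // IH //=; case: ifP; rewrite ?k1N ?k2N.
- by case/andP=> eN k1N; rewrite eval_upd //; case: ifP => _; rewrite IH //= geq_max k1N eN.
- by move=> xN; rewrite !(fun s a => updC s a v xN) !IH // join_map.
- by move=> xN; rewrite updC // IH.
- by move=> eN; rewrite eval_upd // IH.
- by move=> eN; rewrite eval_upd // IH.
- by case/andP=> eN fN; rewrite !eval_upd // IH.
- by case/andP=> xN eN; rewrite eval_upd // !(fun s a => updC s a v xN) !IH // join_map.
Qed.


Lemma run_cat t1 t2 ks1 ks2 c L :
  run t1 ks1 c = Some L -> all (fun c' => isSome (run t2 ks2 c')) L ->
  run (t1 + t2) (ks1 ++ ks2) c =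
    Some (flatten [seq odflt [::] (run t2 ks2 c') | c' <- L]).
Proof.
have run_nil t c0 L0 : run t [::] c0 = Some L0 -> all (fun c' => isSome (run t2 ks2 c')) L0 ->
    run (t + t2) ks2 c0 = Some (flatten [seq odflt [::] (run t2 ks2 c') | c' <- L0]).
  have -> : run t [::] c0 = Some [:: c0] by case: t.
  case=> <-; rewrite [all _ _]andbT [flatten _]cats0; case E: (run t2 ks2 _) => [l|] // _.
  by rewrite (run_leq _ E) ?leq_addl.
elim: t1 ks1 c L => [|t1 IH] [|k ks1] c L; try exact: run_nil; first by [].
case: c => s q /=.
have join_cat r0 r1 r0' r1' :
      (forall l, r0 = Some l -> all (fun c' => isSome (run t2 ks2 c')) l ->
        r0' = Some (flatten [seq odflt [::] (run t2 ks2 c') | c' <- l])) ->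
      (forall l, r1 = Some l -> all (fun c' => isSome (run t2 ks2 c')) l ->
        r1' = Some (flatten [seq odflt [::] (run t2 ks2 c') | c' <- l])) ->
      @join_branches R r0 r1 = Some L -> all (fun c' => isSome (run t2 ks2 c')) L ->
      join_branches r0' r1' =
        Some (flatten [seq odflt [::] (run t2 ks2 c') | c' <- L]).
    case: r0 r1 => [l|] [l'|] // h0 h1 [<-]; rewrite all_cat => /andP[a0 a1].
    by rewrite (h0 _ erefl a0) (h1 _ erefl a1) /= map_cat flatten_cat.
case: k => [x e|k1 k2|e k1 k2|e k1|x|x|e|e|e f|x e];
  try (move=> h a; exact: IH h a);
  try (by apply: join_cat => l h a; apply: IH h a).
by case: ifP => _ h a; exact: IH h a.
Qed.

(* Halting within [t] steps with [Q] having probability at least [p]; the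
   quantification over [q] restricts this to programs that do not use the
   quantum register. *)
Definition reach (t : nat) (p : R) ks s (Q : pred store) : Prop :=
  forall q, exists2 L, run t ks (s, q) = Some L &
    p * sqnorm q <= \sum_(c <- L | Q c.1) sqnorm c.2.

Lemma reach_weaken t t' p p' ks s Q :
  reach t p ks s Q -> (t <= t')%N -> p' <= p -> reach t' p' ks s Q.
Proof.
move=> h le_t le_p q; have [L runL leL] := h q.
exists L; first exact: (run_leq le_t runL).
by apply: le_trans leL; rewrite ler_wpM2r ?sqnorm_ge0.
Qed.

Lemma reach_nil t s (Q : pred store) : reach t (Q s)%:R [::] s Q.
Proof.
move=> q; exists [:: (s, q)]; first by case: t.
by rewrite big_mkcond big_seq1 /=; case: (Q s); rewrite ?mul1r ?mul0r.
Qed.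

Lemma reach_assign t p x e ks s Q :
  reach t p ks (upd s x (Defs.eval s e)) Q -> reach t.+1 p (Assign x e :: ks) s Q.
Proof. by move=> h q; have [L] := h q; exists L. Qed.

Lemma reach_seq t p k1 k2 ks s Q :
  reach t p [:: k1, k2 & ks] s Q -> reach t.+1 p (Seq k1 k2 :: ks) s Q.
Proof. by move=> h q; have [L] := h q; exists L. Qed.

Lemma reach_if t p e k1 k2 ks s Q :
  reach t p ((if is_leaf (Defs.eval s e) then k2 else k1) :: ks) s Q ->
  reach t.+1 p (If e k1 k2 :: ks) s Q.
Proof. by move=> h q; have [L] := h q; exists L. Qed.

Lemma reach_while t p e k ks s Q :
  reach t p (if is_leaf (Defs.eval s e) then ks else [:: k, While e k & ks]) s Q ->
  reach t.+1 p (While e k :: ks) s Q.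
Proof.
by move=> h q; have [L] := h q; exists L => //=; case: ifP p0 => //= ->.
Qed.

Lemma reach_flip t p0 p1 x ks s Q :
  reach t p0 ks (upd s x (tree_of_bool false)) Q ->
  reach t p1 ks (upd s x (tree_of_bool true)) Q ->
  reach t.+1 ((p0 + p1) / 2) (Flip x :: ks) s Q.
Proof.
move=> h0 h1 q; have [L0 run0 le0] := h0 (qscale (Complex (rsqrt2 R) 0) q).
have [L1 run1 le1] := h1 (qscale (Complex (rsqrt2 R) 0) q).
exists (L0 ++ L1); first by rewrite /= run0 run1.
rewrite big_cat /= (le_trans _ (lerD le0 le1)) // !sqnorm_coin; lra.
Qed.

(** Continuation form of the assertion that [k] computes [f] in [w] steps; it composes with whatever
    coin flips follow. *)
Definition det (w : nat) (k : cmd) (f : store -> store) : Prop :=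
  forall t p ks s Q, reach t p ks (f s) Q -> reach (w + t) p (k :: ks) s Q.

Lemma det_assign x e : det 1 (Assign x e) (fun s => upd s x (Defs.eval s e)).
Proof. by move=> t p ks s Q h; apply: reach_assign. Qed.

Lemma det_seq w1 w2 k1 k2 f g :
  det w1 k1 f -> det w2 k2 g -> det (w1 + w2).+1 (Seq k1 k2) (g \o f).
Proof. by move=> d1 d2 t p ks s Q h; rewrite addSn -addnA; apply/reach_seq/d1/d2. Qed.

(** The list in [x] is the loop counter: each pass costs [w] and one test, and the last, failing
    test costs one more unit. *)
Lemma reach_loop w x k f t p ks s Q :
  det w k f ->
  (forall s, size (seq_of_tree (f s x)) = (size (seq_of_tree (s x))).-1) ->
  reach t p ks (iter (size (seq_of_tree (s x))) f s) Q ->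
  reach ((size (seq_of_tree (s x)) * w.+1).+1 + t) p (While (Var x) k :: ks) s Q.
Proof.
move=> df szf; move Dm: (size _) => m; elim: m s Dm => [|m IH] s Dm h.
  by rewrite addSn; apply: reach_while; rewrite /= is_leafE Dm.
rewrite addSn; apply: reach_while; rewrite /= is_leafE Dm /=.
have -> : (m.+1 * w.+1 + t = w + ((m * w.+1).+1 + t))%N by lia.
by apply: df; apply: IH; rewrite ?szf ?Dm // -iterSr.
Qed.

End Run.

(** * Setting a random bit *)

Definition assign x e s := upd s x (Defs.eval s e).

(* Variable 0 is the characteristic vector, [y] a list of length [n], 1 the list
   of candidate positions and, while it is halved, 2 and 3 its two halves; 4 is
   a position, in unary, 5 the reversed prefix of 0 already passed, and 6 a bit
   or a temporary. *)
Definition push_suffix : cmd :=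
  Seq (Assign 4 (ERight (Var 4))) (Assign 1 (ENode (Var 4) (Var 1))).

(** No parity bit is kept: the new element always goes onto list 3, and then lists 2 and 3 exchange
    names. This alternation keeps the two halves balanced. *)
Definition deal : cmd :=
  Seq (Assign 6 (Var 2)) (Seq (Assign 2 (ENode (ELeft (Var 1)) (Var 3)))
    (Seq (Assign 3 (Var 6)) (Assign 1 (ERight (Var 1))))).

Definition halve : cmd :=
  Seq (Assign 2 ELeaf) (Seq (Assign 3 ELeaf) (Seq (While (Var 1) deal)
    (Seq (Flip 6) (If (Var 6) (Assign 1 (Var 2)) (Assign 1 (Var 3)))))).

Definition advance : cmd :=
  Seq (Assign 5 (ENode (ELeft (Var 0)) (Var 5)))
    (Seq (Assign 0 (ERight (Var 0))) (Assign 4 (ERight (Var 4)))).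

Definition rewind : cmd :=
  Seq (Assign 0 (ENode (ELeft (Var 5)) (Var 0))) (Assign 5 (ERight (Var 5))).

Definition pick (y : nat) : cmd :=
  Seq (Assign 4 (Var y)) (Seq (Assign 1 ELeaf)
    (Seq (While (Var 4) push_suffix) (While (ERight (Var 1)) halve))).

Definition write : cmd :=
  Seq (Assign 4 (ELeft (Var 1))) (Seq (Assign 5 ELeaf)
    (Seq (While (Var 4) advance) (Seq (Flip 6)
    (Seq (Assign 0 (ENode (Var 6) (ERight (Var 0)))) (While (Var 5) rewind))))).

Definition mutate (y : nat) : cmd := Seq (pick y) write.

(** Candidate positions are proper suffixes of the list in [y], the suffix of length [i] standing
    for [i]; only lengths matter. *)
Definition lengths (s : store) x : seq nat := [seq size (seq_of_tree a) | a <- seq_of_tree (s x)].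

Lemma iter_frame (f : store -> store) x m s :
  (forall s, f s x = s x) -> iter m f s x = s x.
Proof. by move=> fx; elim: m => //= m <-. Qed.

Definition push_suffix_fun : store -> store :=
  assign 1 (ENode (Var 4) (Var 1)) \o assign 4 (ERight (Var 4)).

Lemma lengths_push_suffix m s :
  size (seq_of_tree (s 4%N)) = m ->
  lengths (iter m push_suffix_fun s) 1 = iota 0 m ++ lengths s 1.
Proof.
elim: m s => // m IH s sz4; rewrite iterSr IH; last first.
  by rewrite /push_suffix_fun /= /assign /upd /= seq_of_tright size_behead sz4.
have -> : lengths (push_suffix_fun s) 1 = m :: lengths s 1.
  by rewrite /lengths /= seq_of_tright size_behead sz4.
by rewrite -cat_rcons -[in RHS]addn1 iotaD -cats1.
Qed.

Definition deal_fun : store -> store :=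
  assign 1 (ERight (Var 1)) \o assign 3 (Var 6) \o
  assign 2 (ENode (ELeft (Var 1)) (Var 3)) \o assign 6 (Var 2).

Lemma deal_funE s x : deal_fun s x =
  match x with
  | 1 => tright (s 1%N)
  | 2 => Node (tleft (s 1%N)) (s 3%N)
  | 3 => s 2%N
  | 6 => s 2%N
  | _ => s x
  end%N.
Proof. by do 7!case: x => [|x] //. Qed.

Lemma lengths_deal m s (s' := iter m deal_fun s) :
  size (seq_of_tree (s 1%N)) = m ->
  (size (lengths s 3) <= size (lengths s 2) <= (size (lengths s 3)).+1)%N ->
  [/\ perm_eq (lengths s' 2 ++ lengths s' 3) (lengths s 1 ++ lengths s 2 ++ lengths s 3) &
      size (lengths s' 3) <= size (lengths s' 2) <= (size (lengths s' 3)).+1]%N.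
Proof.
rewrite {}/s'; elim: m s => [|m IH] s sz1 bal.
  by split=> //=; rewrite [lengths s 1]size0nil // size_map.
rewrite iterSr; set s1 := deal_fun s.
have l1 : lengths s 1 = head 0%N (lengths s 1) :: lengths s1 1.
  by rewrite /lengths /s1 deal_funE seq_of_tright; case: (seq_of_tree (s 1%N)) sz1.
have l2 : lengths s1 2 = head 0%N (lengths s 1) :: lengths s 3.
  by rewrite /lengths /s1 deal_funE /= tleft_head; case: (seq_of_tree (s 1%N)) sz1.
have l3 : lengths s1 3 = lengths s 2 by rewrite /lengths /s1 deal_funE.
have sz1' : size (seq_of_tree (s1 1%N)) = m.
  by rewrite /s1 deal_funE seq_of_tright size_behead sz1.
case: (IH s1) => //.
  by rewrite l2 l3 /= ltnS; case/andP: bal => -> ->.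
move=> perm_m bal_m; split=> //; rewrite (perm_trans perm_m) // l2 l3 [lengths s 1]l1.
apply/permP => a; rewrite !count_cat /=; lia.
Qed.

Definition advance_fun : store -> store :=
  assign 4 (ERight (Var 4)) \o assign 0 (ERight (Var 0)) \o
  assign 5 (ENode (ELeft (Var 0)) (Var 5)).

Lemma advance_funE s x : advance_fun s x =
  match x with
  | 0 => tright (s 0%N)
  | 4 => tright (s 4%N)
  | 5 => Node (tleft (s 0%N)) (s 5%N)
  | _ => s x
  end%N.
Proof. by do 6!case: x => [|x] //. Qed.

(** The output of [A] is arbitrary, so the list in variable 0 may be shorter than [m]. The prefix is
    then padded with [Leaf], which [output_set] reads as absence of the vertex. *)
Lemma iter_advance m s (s' := iter m advance_fun s) (l := seq_of_tree (s 0%N)) :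
  seq_of_tree (s' 0%N) = drop m l /\
  seq_of_tree (s' 5%N) = catrev (mkseq (nth Leaf l) m) (seq_of_tree (s 5%N)).
Proof.
rewrite {}/s' {}/l; elim: m => [|m [IH0 IH5]]; first by rewrite drop0.
rewrite mkseqS -cats1 catrev_catl !iterS !advance_funE seq_of_tright tleft_head /= IH0 IH5.
by rewrite -drop1 drop_drop add1n -nth0 nth_drop addn0.
Qed.

Definition rewind_fun : store -> store :=
  assign 5 (ERight (Var 5)) \o assign 0 (ENode (ELeft (Var 5)) (Var 0)).

Lemma rewind_funE s x : rewind_fun s x =
  match x with
  | 0 => Node (tleft (s 5%N)) (s 0%N)
  | 5 => tright (s 5%N)
  | _ => s x
  end%N.
Proof. by do 6!case: x => [|x] //. Qed.

Lemma iter_rewind m s :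
  size (seq_of_tree (s 5%N)) = m ->
  seq_of_tree (iter m rewind_fun s 0%N) =
    catrev (seq_of_tree (s 5%N)) (seq_of_tree (s 0%N)).
Proof.
elim: m s => [|m IH] s sz5; first by rewrite [seq_of_tree (s 5%N)]size0nil.
rewrite iterSr IH !rewind_funE seq_of_tright ?size_behead ?sz5 //= tleft_head.
by case: (seq_of_tree (s 5%N)) sz5.
Qed.

Section Mutate.
Variables (R : realType) (N : nat).
(** The offset 7 clears the variables 0 to 6 of the mutation code; [N] will be a bound on the
    variables of [A]. *)
Let y := N.+4.+3.

Lemma det_push_suffix : det R 3 push_suffix push_suffix_fun.
Proof. by apply: (@det_seq _ 1 1); apply: det_assign. Qed.

Lemma det_deal : det R 7 deal deal_fun.
Proof.
apply: (@det_seq _ 1 5); first exact: det_assign.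
apply: (@det_seq _ 1 3); first exact: det_assign.
by apply: (@det_seq _ 1 1); apply: det_assign.
Qed.

Lemma det_advance : det R 5 advance advance_fun.
Proof.
apply: (@det_seq _ 1 3); first exact: det_assign.
by apply: (@det_seq _ 1 1); apply: det_assign.
Qed.

Lemma det_rewind : det R 3 rewind rewind_fun.
Proof. by apply: (@det_seq _ 1 1); apply: det_assign. Qed.

Lemma size_lengths s x : size (lengths s x) = size (seq_of_tree (s x)).
Proof. exact: size_map. Qed.

(** Induction on [r]: if [i] is a candidate, the coin keeps a half containing it with probability at
    least one half. The continuation is assumed for every outcome, with probability 0 for the wrong
    ones, because all paths must still halt in time. *)
Lemma reach_halve n r t (p : R) i ks s Q :
  0 <= p -> (size (lengths s 1) <= n)%N -> (size (lengths s 1) <= 2 ^ r)%N ->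
  (forall s', s' 0%N = s 0%N -> s' y = s y -> {subset lengths s' 1 <= lengths s 1} ->
     reach t (if lengths s' 1 == [:: i] then p else 0) ks s' Q) ->
  reach ((r * (8 * n + 20)).+1 + t) (if i \in lengths s 1 then p / 2 ^+ r else 0)
    (While (ERight (Var 1)) halve :: ks) s Q.
Proof.
move=> p0; elim: r s => [|r IH] s le_n le_r h;
  rewrite addSn; apply: reach_while;
  rewrite /= is_leafE seq_of_tright size_behead -size_lengths.
  have small: (size (lengths s 1)).-1 == 0%N by rewrite -subn1 subn_eq0.
  rewrite small; apply: (reach_weaken (h s erefl erefl (fun _ => id))); first lia.
  rewrite expr0 divr1; case: ifPn => [i_s|_]; last by case: ifP.
  by case: (lengths s 1) small i_s => [|a [|b l]] //= _; rewrite inE => /eqP->; rewrite eqxx.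
(* The list may be down to one element before [r] halvings; [p] then exceeds the claimed bound. *)
case: (boolP ((size (lengths s 1)).-1 == 0)%N) => [small|].
  apply: (reach_weaken (h s erefl erefl (fun _ => id))); first lia.
  case: ifPn => [i_s|_]; last by case: ifP.
  have -> : lengths s 1 = [:: i].
    by case: (lengths s 1) small i_s => [|a [|b l]] //= _; rewrite inE => /eqP->.
  by rewrite eqxx ler_piMr // invf_le1 ?exprn_ege1 ?exprn_gt0 ?ler1n.
rewrite -subn1 subn_eq0 -ltnNge => big.
set m := size (lengths s 1) in le_n le_r big.
(* Cost of one round: 5 units up to the loop, 7 and a test per dealt element, the final test, and 4
   for sequencing, coin, conditional and assignment. *)
suff reach_body : reach (5 + ((m * 8).+1 + (4 + ((r * (8 * n + 20)).+1 + t))))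
    (if i \in lengths s 1 then p / 2 ^+ r.+1 else 0)
    [:: halve, While (ERight (Var 1)) halve & ks] s Q.
  by apply: (reach_weaken reach_body) => //; lia.
do 2!(apply: reach_seq; apply: reach_assign); apply: reach_seq => /=.
set s1 := upd _ _ _.
have lens_s1 : lengths s1 1 = lengths s 1 by [].
have sz1 : size (seq_of_tree (s1 1%N)) = m by rewrite -size_lengths lens_s1.
rewrite -sz1; apply: (reach_loop det_deal).
  by move=> s'; rewrite deal_funE seq_of_tright size_behead.
rewrite sz1; set s2 := iter m deal_fun s1.
have [//|perm_s2 bal_s2] := lengths_deal sz1 _.
rewrite -/s2 cats0 lens_s1 in perm_s2 bal_s2.
have frame x : x \notin [:: 1; 2; 3; 6]%N -> s2 x = s x.
  move=> x_out; rewrite /s2 iter_frame => [|s']; last first.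
    by move: x_out; rewrite deal_funE; do 7!case: x => [|x] //.
  by move: x_out; rewrite /s1 /upd; do 4!case: x => [|x] //.
have sizes : (size (lengths s2 2) + size (lengths s2 3))%N = m by rewrite -size_cat (perm_size perm_s2).
have sub_s2 x : x \in lengths s2 2 ++ lengths s2 3 -> x \in lengths s 1.
  by rewrite (perm_mem perm_s2).
apply: reach_seq.
have branch (b : bool) : reach (2 + ((r * (8 * n + 20)).+1 + t))
    (if i \in lengths s2 (if b then 2 else 3)%N then p / 2 ^+ r else 0)
    [:: If (Var 6) (Assign 1 (Var 2)) (Assign 1 (Var 3)), While (ERight (Var 1)) halve & ks]
    (upd s2 6 (tree_of_bool b)) Q.
  apply: reach_if; rewrite [if is_leaf _ then _ else _](_ : _ =
    Assign 1 (Var (if b then 2 else 3)%N)); last by case: b.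
  apply: reach_assign; set s3 := upd _ _ _.
  have lens_s3 : lengths s3 1 = lengths s2 (if b then 2 else 3)%N by rewrite {}/s3; case: b.
  have [s3_0 s3_y] : s3 0%N = s2 0%N /\ s3 y = s2 y by [].
  clearbody s3.
  rewrite -lens_s3; apply: IH => [||s' s'0 s'y s'1].
  - by rewrite lens_s3; case: (b) => /=; lia.
  - by move: le_r; rewrite expnS lens_s3; case: (b) => /=; lia.
  apply: h => [||x /s'1]; first by rewrite s'0 s3_0 frame.
    by rewrite s'y s3_y frame.
  rewrite lens_s3 => x_s2; apply: sub_s2; rewrite mem_cat.
  by case: (b) x_s2 => ->; rewrite ?orbT.
apply: (reach_weaken (reach_flip (branch false) (branch true))) => //.
have pr0 : 0 <= p / 2 ^+ r by rewrite divr_ge0 ?exprn_ge0.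
rewrite exprSr invfM mulrA -(perm_mem perm_s2) mem_cat /=.
by case: (i \in lengths s2 2); case: (i \in lengths s2 3) => /=; lra.
Qed.

(** The chosen position [i'] may differ from the target [i], and the coin from [b]; [h0] covers both
    failures by demanding only that the rest halts. Contents are compared through [nth Leaf], which
    hides any padding. *)
Lemma reach_write n t (p : R) i (b : bool) ks s Q (i' := head 0%N (lengths s 1)) :
  0 <= p -> (i' <= n)%N ->
  (forall s', s' y = s y -> reach t (0 : R) ks s' Q) ->
  (forall s', s' y = s y ->
     (forall j, nth Leaf (seq_of_tree (s' 0%N)) j =
        if j == i then tree_of_bool b else nth Leaf (seq_of_tree (s 0%N)) j) ->
     reach t p ks s' Q) ->
  reach (10 * n + 20 + t) (if i' == i then p / 2 else 0) (write :: ks) s Q.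
Proof.
move=> p0 le_n h0 h.
suff reach_body : reach (5 + ((i' * 6).+1 + (4 + ((i' * 4).+1 + t))))
    (if i' == i then p / 2 else 0) (write :: ks) s Q.
  by apply: (reach_weaken reach_body) => //; lia.
do 2!(apply: reach_seq; apply: reach_assign); apply: reach_seq => /=.
set s1 := upd _ _ _.
have sz1 : size (seq_of_tree (s1 4%N)) = i'.
  rewrite /s1 /upd /= tleft_head /i' /lengths.
  by case: (seq_of_tree (s 1%N)).
rewrite -sz1; apply: (reach_loop det_advance).
  by move=> s'; rewrite advance_funE seq_of_tright size_behead.
rewrite sz1; set s2 := iter i' advance_fun s1.
have [s2_0 s2_5] := iter_advance i' s1.
rewrite -/s2 in s2_0 s2_5.
have s2_y : s2 y = s y by rewrite /s2 iter_frame // => s'; rewrite advance_funE.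
apply: reach_seq.
have branch (c : bool) : reach (2 + ((i' * 4).+1 + t))
    (if (i' == i) && (c == b) then p else 0)
    [:: Seq (Assign 0 (ENode (Var 6) (ERight (Var 0)))) (While (Var 5) rewind) & ks]
    (upd s2 6 (tree_of_bool c)) Q.
  apply: reach_seq; apply: reach_assign; set s3 := upd _ _ _.
  have s3_0 : seq_of_tree (s3 0%N) = tree_of_bool c :: drop i'.+1 (seq_of_tree (s 0%N)).
    by rewrite /s3 /upd /= seq_of_tright s2_0 -drop1 drop_drop add1n.
  have s3_5 : seq_of_tree (s3 5%N) = rev (mkseq (nth Leaf (seq_of_tree (s 0%N))) i').
    by rewrite /s3 /upd /= s2_5 catrevE cats0.
  have s3_y : s3 y = s y by rewrite -s2_y.
  clearbody s3.
  have sz5 : size (seq_of_tree (s3 5%N)) = i' by rewrite s3_5 size_rev size_mkseq.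
  rewrite -{1}sz5; apply: (reach_loop det_rewind).
    by move=> s'; rewrite rewind_funE seq_of_tright size_behead.
  rewrite sz5; set s4 := iter _ _ _.
  have s4_y : s4 y = s y by rewrite /s4 iter_frame // => s'; rewrite rewind_funE.
  case: ifP => [/andP[/eqP def_i /eqP def_c]|_]; last exact: h0.
  apply: h => // j; rewrite /s4 iter_rewind // s3_5 s3_0 catrevE revK nth_cat size_mkseq.
  rewrite -def_i -def_c; case: (ltngtP j i') => [lt_j|gt_j|->].
  - by rewrite nth_mkseq.
  - by rewrite -subnSK //= nth_drop addSnnS subnSK // subnKC // ltnW.
  - by rewrite subnn.
apply: (reach_weaken (reach_flip (branch false) (branch true))) => //.
by case: (i' == i); case: (b) => /=; lra.
Qed.

(** The factor [2 ^+ r.+1] accounts for at most [r] halving coins and one coin for the bit. The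
    program does not mention [r], which serves only the analysis. *)
Lemma reach_mutate n r t (p : R) i (b : bool) ks s Q :
  0 <= p -> size (seq_of_tree (s y)) = n -> (n <= 2 ^ r)%N ->
  (forall s', s' y = s y -> reach t (0 : R) ks s' Q) ->
  (forall s', s' y = s y ->
     (forall j, nth Leaf (seq_of_tree (s' 0%N)) j =
        if j == i then tree_of_bool b else nth Leaf (seq_of_tree (s 0%N)) j) ->
     reach t p ks s' Q) ->
  reach (r * (8 * n + 20) + 20 * n + 30 + t)
    (if (i < n)%N then p / 2 ^+ r.+1 else 0) (mutate y :: ks) s Q.
Proof.
move=> p0 size_y le_nr h0 h.
suff reach_body : reach (6 + ((n * 4).+1 + ((r * (8 * n + 20)).+1 + (10 * n + 20 + t))))
    (if (i < n)%N then p / 2 ^+ r.+1 else 0) (mutate y :: ks) s Q.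
  by apply: (reach_weaken reach_body) => //; lia.
apply: reach_seq; do 2!(apply: reach_seq; apply: reach_assign); apply: reach_seq => /=.
set s1 := upd _ _ _.
have sz1 : size (seq_of_tree (s1 4%N)) = n by [].
rewrite -[X in (X * 4)%N]sz1; apply: (reach_loop det_push_suffix).
  by move=> s'; rewrite /= seq_of_tright size_behead.
rewrite sz1; set s2 := iter n push_suffix_fun s1.
have lens_s2 : lengths s2 1 = iota 0 n by rewrite lengths_push_suffix // cats0.
have frame x : x \notin [:: 1; 4]%N -> s2 x = s x.
  move=> x_out; rewrite /s2 iter_frame => [|s']; move: x_out.
    by rewrite /s1 /upd; do 5!case: x => [|x] //.
  by rewrite /= /assign /upd; do 5!case: x => [|x] //.
have -> : (if (i < n)%N then p / 2 ^+ r.+1 else 0) =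
    if i \in lengths s2 1 then (p / 2) / 2 ^+ r else 0.
  by rewrite lens_s2 mem_iota exprS invfM mulrA.
apply: (@reach_halve n) => [||| s' s'0 s'y s'1].
- by rewrite divr_ge0.
- by rewrite lens_s2 size_iota.
- by rewrite lens_s2 size_iota.
have le_head : (head 0%N (lengths s' 1) <= n)%N.
  case: (lengths s' 1) s'1 => //= a l /(_ a); rewrite inE eqxx lens_s2 mem_iota.
  by move=> /(_ isT) /andP[_ /ltnW].
have reach_w := @reach_write n t p i b ks s' Q p0 le_head _ _.
apply: (reach_weaken (reach_w _ _)) => //.
- by move=> s3 s3y; apply: h0; rewrite s3y s'y frame.
- move=> s3 s3y s3_0; apply: h; first by rewrite s3y s'y frame.
  by move=> j; rewrite s3_0 s'0 frame.
- case: eqP => [->|_]; rewrite ?eqxx //; case: ifP => //; rewrite divr_ge0 //.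
Qed.

End Mutate.

(** * Random mutations of the output *)

Definition symdiff (T : finType) (A B : {set T}) : {set T} :=
  (A :\: B) :|: (B :\: A).

Lemma in_symdiff (T : finType) (A B : {set T}) x :
  (x \in symdiff A B) = ((x \in A) != (x \in B)).
Proof. by rewrite !inE; case: (x \in A); case: (x \in B). Qed.

Lemma symdiff_eq0 (T : finType) (A B : {set T}) :
  (#|symdiff A B| <= 0)%N = (A == B).
Proof.
rewrite leqn0 cards_eq0; apply/eqP/eqP => [AB0|->].
  apply/setP => x; have := in_symdiff A B x; rewrite AB0 inE.
  by case: (x \in A); case: (x \in B).
by apply/setP => x; rewrite in_symdiff inE eqxx.
Qed.

(** The final assignment acts as a skip: variable 6 is no part of the output. *)
Definition mutations (D y : nat) : cmd := iter D (Seq (mutate y)) (Assign 6 ELeaf).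

Definition mutate_time (r n : nat) : nat := (r * (8 * n + 20) + 20 * n + 30)%N.

Section Mutations.
Variable R : realType.
Implicit Types (s : store) (q : qstate R) (c : config R).

(** Each of the [D] mutations is asked to repair one vertex of the symmetric difference. *)
Lemma reach_mutations N D n r s (S : {set 'I_n}) (y := N.+4.+3) :
  size (seq_of_tree (s y)) = n -> (n <= 2 ^ r)%N ->
  reach (D * (mutate_time r n).+1).+1
    (if (0 < n)%N && (#|symdiff (output_set n s) S| <= D)%N
     then (2 ^- r.+1) ^+ D else 0 : R)
    [:: mutations D y] s (fun s' => output_set n s' == S).
Proof.
move=> + le_nr; elim: D s => [|D IH] s size_y.
  rewrite mul0n; apply: reach_assign.
  apply: (reach_weaken (@reach_nil R 0%N _ _)) => //.
  rewrite symdiff_eq0 expr0 [output_set n (upd _ _ _)](_ : _ = output_set n s) //.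
  by case: eqP; case: (0 < n)%N.
set p : R := (2 ^- r.+1) ^+ D.
have p_ge0 : 0 <= p by rewrite exprn_ge0 // invr_ge0 exprn_ge0.
have IH0 s' : s' y = s y -> reach (D * (mutate_time r n).+1).+1 (0 : R)
    [:: mutations D y] s' (fun s' => output_set n s' == S).
  move=> s'y; have := IH s'; rewrite s'y => /(_ size_y) IHs.
  by apply: (reach_weaken IHs) => //; case: ifP.
suff reach_body : reach (mutate_time r n + (D * (mutate_time r n).+1).+1)
    (if (0 < n)%N && (#|symdiff (output_set n s) S| <= D.+1)%N
     then p / 2 ^+ r.+1 else 0) [:: mutate y; mutations D y] s
    (fun s' => output_set n s' == S).
  apply: reach_seq; apply: (reach_weaken reach_body); first by lia.
  by rewrite exprSr.
case: ifP => [/andP[n_gt0 le_D]|_]; last first.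
  (* With [p = 0] only halting is asserted; position 0 and bit [true] are arbitrary. *)
  have := @reach_mutate R N n r _ 0 0 true _ s _ (lexx 0) size_y le_nr IH0 (fun s' s'y _ => IH0 s' s'y).
  by rewrite mul0r if_same.
(* If the set already equals [S], the mutation is spent on rewriting the correct bit of an arbitrary
   vertex, which exists since [0 < n]. *)
have [i le_Di] : exists i : 'I_n, (#|symdiff (output_set n s) S :\ i| <= D)%N.
  have [sym0|[i iS]] := set_0Vmem (symdiff (output_set n s) S).
    by exists (Ordinal n_gt0); rewrite sym0 finset.set0D cards0.
  by exists i; move: le_D; rewrite (cardsD1 i) iS.
have := @reach_mutate R N n r _ p i (i \in S) _ s _ p_ge0 size_y le_nr IH0.
rewrite ltn_ord; apply=> s' s'y out_s'.
have := IH s'; rewrite s'y => /(_ size_y).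
suff -> : symdiff (output_set n s') S = symdiff (output_set n s) S :\ i.
  by rewrite n_gt0 le_Di.
apply/setP => j; rewrite in_setD1 !in_symdiff !finset.in_set out_s'.
case: (eqVneq j i) => [->|neq_ji]; first by rewrite eqxx; case: (i \in S).
by rewrite (inj_eq val_inj) (negbTE neq_ji).
Qed.

(** [A] may overwrite its input, so the adjacency matrix is first copied to a fresh variable; the
    mutations use only its length, which is [n]. *)
Definition mutant (A : cmd) (D : nat) : cmd :=
  let y := (cmd_bound A).+4.+3 in Seq (Assign y (Var 0)) (Seq A (mutations D y)).

Lemma run_mutant (A : cmd) D t n r (G : graph n) k L :
  (n <= 2 ^ r)%N -> exec R A t G k = Some L ->
  exists2 L', exec R (mutant A D) (t + (D * (mutate_time r n).+1 + 4)) G k = Some L' &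
    forall S : {set 'I_n}, (0 < n)%N ->
      (2 ^- r.+1) ^+ D *
        (\sum_(c <- L | (#|symdiff (output_set n c.1) S| <= D)%N) sqnorm c.2) <=
      \sum_(c <- L' | output_set n c.1 == S) @sqnorm R c.2.
Proof.
move=> le_nr; rewrite /exec => runL.
set y := (cmd_bound A).+4.+3; set v := input_store G k 0%N.
have size_v : size (seq_of_tree v) = n by rewrite tree_of_seqK size_map size_enum_ord.
pose save c : config R := (upd c.1 y v, c.2).
have runL' : run t [:: A] (upd (input_store G k) y v, qinit R) = Some (map save L).
  by rewrite run_upd ?runL //= andbT /y; lia.
set T := (D * (mutate_time r n).+1).+1.
have save_y c : size (seq_of_tree ((save c).1 y)) = n by rewrite /save /upd /= eqxx.
have reach_L (S : {set 'I_n}) c : exists2 l, run T [:: mutations D y] (save c) = Some l &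
    (if (0 < n)%N && (#|symdiff (output_set n c.1) S| <= D)%N
     then (2 ^- r.+1) ^+ D else 0) * sqnorm c.2 <=
    \sum_(c' <- l | output_set n c'.1 == S) sqnorm c'.2.
  exact: (@reach_mutations (cmd_bound A) D n r (save c).1 S (save_y c) le_nr c.2).
set f := fun c => odflt [::] (run T [:: mutations D y] (save c)).
exists (flatten (map f L)).
  (* The three extra units are the two [Seq] and the saving assignment. *)
  have -> : (t + (D * (mutate_time r n).+1 + 4) = (t + T).+3)%N by rewrite /T; lia.
  have halts : all (fun c => isSome (run T [:: mutations D y] c)) (map save L).
    rewrite all_map (eq_all (a2 := predT)) ?all_predT // => c.
    by have [l run_l _] := reach_L finset.set0 c; move: (congr1 isSome run_l).
  have run_save := run_cat runL' halts; rewrite -map_comp in run_save.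
  exact: run_save.
move=> S n_gt0; rewrite big_flatten big_map mulr_sumr [X in X <= _]big_mkcond.
apply: ler_sum => c _; have [l run_l] := reach_L S c.
rewrite /f run_l /= n_gt0 /= => le_l; apply: le_trans le_l.
by case: ifP; rewrite ?mul0r.
Qed.

Lemma mutant_time a D : exists d, forall n,
  (n ^ a + a + (D * (mutate_time (up_log 2 n) n).+1 + 4) <= n ^ d + d)%N.
Proof.
(* For [n >= 2], the exponent 2 pays for [mutate_time] and [n ^ (100 * D) > 100 * D] absorbs the
   factor [D]; for [n <= 1] the additive term of the time bound does the work. *)
exists (a + 2 + 100 * D + 5)%N => n.
have le_log : (up_log 2 n <= n)%N by apply: up_log_min => //; rewrite ltnW // ltn_expl.
have le_t : ((mutate_time (up_log 2 n) n).+1 <= 8 * n ^ 2 + 40 * n + 31)%N.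
  rewrite /mutate_time -mulnn; nia.
have le_Dt := leq_mul (leqnn D) le_t.
case: n => [|[|n]] in le_log le_t le_Dt *.
- have : (0 ^ a <= 1)%N by case: (a) => // a'; rewrite exp0n.
  by move: le_Dt; rewrite exp0n // !muln0; lia.
- by move: le_Dt; rewrite !exp1n !muln1; lia.
set m := n.+2 in le_Dt *.
have m2 : (m = n + 2)%N by rewrite /m; lia.
have pow_a : (0 < m ^ a)%N by rewrite expn_gt0.
have pow_ge : (100 * D < m ^ (100 * D))%N by rewrite ltn_expl.
have -> : (a + 2 + 100 * D + 5 = 2 + a + 100 * D + 5)%N by lia.
rewrite (expnD m (2 + a + 100 * D)) (expnD m (2 + a)) (expnD m 2).
have le_pow : (m ^ 2 * m ^ a * (100 * D + 1) <= m ^ 2 * m ^ a * m ^ (100 * D) * m ^ 5)%N.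
  by rewrite -[X in (X <= _)%N]muln1 leq_mul ?expn_gt0 // leq_mul // addn1.
have le_Y : (m ^ a <= m ^ 2 * m ^ a)%N by rewrite leq_pmull ?expn_gt0.
have le_X : (36 * (m ^ 2 * D) <= 100 * (m ^ 2 * m ^ a * D))%N.
  by rewrite leq_mul // leq_mul // leq_pmulr.
have le_q : (8 * m ^ 2 + 40 * m + 31 <= 36 * m ^ 2)%N by rewrite -mulnn; nia.
have le_Dq := leq_mul (leqnn D) le_q.
lia.
Qed.

End Mutations.

(** * Cliques far from the planted one *)

Lemma leq_bin_exp n m : ('C(n, m) <= n ^ m)%N.
Proof.
apply: (@leq_trans (n ^_ m)).
  by rewrite -bin_ffact leq_pmulr // fact_gt0.
elim: m n => [|m IH] n; first by rewrite ffactn0.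
case: n => [|n]; first by rewrite ffact0n.
rewrite ffactSS expnS leq_mul //; apply: leq_trans (IH n) _.
by case: (m) => // m'; rewrite leq_exp2r.
Qed.

(** The base case is [32^6 = 2^30]; afterwards [(k + 1)^6 <= 2 k^6]. *)
Lemma exp6_leq_exp2 k : (32 <= k)%N -> (k ^ 6 <= 2 ^ k.-1)%N.
Proof.
move=> le_k; rewrite -(subnK le_k); elim: (k - 32)%N => [|d IH].
  by rewrite add0n -[32%N]/(2 ^ 5)%N -expnM leq_exp2l.
have -> : ((d.+1 + 32).-1 = (d + 32).-1.+1)%N by lia.
rewrite [X in (_ <= X)%N]expnS; apply: (leq_trans _ (leq_mul (leqnn 2) IH)).
set a := (d + 32)%N; have a32 : (32 <= a)%N by rewrite /a; lia.
have -> : (d.+1 + 32 = a.+1)%N by rewrite /a.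
(* For [a >= 32] the ratio [(a + 1)^2 / a^2] is at most [5/4], and the cube of [5/4] is
   [125/64 < 2]. *)
have : ((4 * a.+1 ^ 2) ^ 3 <= (5 * a ^ 2) ^ 3)%N.
  by rewrite leq_exp2r // -!mulnn; nia.
rewrite (expnMn 4) (expnMn 5) -!expnM -[(4 ^ 3)%N]/64%N -[(5 ^ 3)%N]/125%N -[(2 * 3)%N]/6%N.
lia.
Qed.

(** If [k^2 <= 2^j], the bound [k^m] on the binomial suffices. Otherwise [j] is small: the binomial
    is ['C(k, j.+1)], whose square is at most [k^(2j+2) <= k^(4j)], and [k^6 <= 2^(j+m)] with
    [2^j < k^2] gives [k^4 <= 2^m]. *)
Lemma bin_sqr_leq m j k :
  (32 <= k)%N -> k = (m + j).+1 -> (0 < j)%N -> ('C(k, m) ^ 2 <= 2 ^ (j * m))%N.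
Proof.
move=> k32 def_k j_gt0; have [k2_le|k2_gt] := leqP (k ^ 2) (2 ^ j).
  apply: (@leq_trans ((k ^ m) ^ 2)); first by rewrite leq_exp2r // leq_bin_exp.
  rewrite -expnM mulnC expnM [(2 ^ (j * m))%N]expnM.
  by case: (m) => // m'; rewrite leq_exp2r.
have -> : 'C(k, m) = 'C(k, j.+1) by rewrite -bin_sub ?def_k; [congr binomial; lia|lia].
have k4_le : (k ^ 4 <= 2 ^ m)%N.
  rewrite -(@leq_pmul2l (2 ^ j)) ?expn_gt0 // -expnD.
  apply: (@leq_trans (k ^ 2 * k ^ 4)); first by rewrite leq_mul // ltnW.
  have -> : (j + m = k.-1)%N by rewrite def_k; lia.
  by rewrite -expnD exp6_leq_exp2.
apply: (@leq_trans ((k ^ 4) ^ j)).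
  apply: (@leq_trans ((k ^ j.+1) ^ 2)); first by rewrite leq_exp2r // leq_bin_exp.
  by rewrite -!expnM leq_pexp2l //; lia.
by rewrite [(j * m)%N]mulnC [(2 ^ (m * j))%N]expnM leq_exp2r.
Qed.

(* ['C(k, m) * 'C(n, j)] bounds the number of (k-1)-sets with [m] vertices inside
   and [j] outside the planted clique, and the exponent on the right is the
   number of pairs that must be edges of [G0].  Squaring makes all exponents
   integral and reduces the claim to [(4 * n ^ 2 / 2 ^ k) ^ j <= n ^ (- 2 h)]. *)
Lemma outside_cliques_leq n m j k J h :
  (32 <= k)%N -> k = (m + j).+1 -> (0 < J <= j)%N ->
  (n ^ (2 * J + 2 * h) * 4 ^ J <= 2 ^ (k * J))%N ->
  ('C(k, m) * 'C(n, j) * n ^ h <= 2 ^ ('C((m + j), 2) - 'C(m, 2)))%N.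
Proof.
move=> k32 def_k /andP[J_gt0 le_J] le_n.
have [->|n_gt0] := posnP n.
  case: (j) le_J => [|j'] le_J; first by move: J_gt0; rewrite ltnNge le_J.
  by rewrite bin0n muln0 mul0n.
have j_gt0 : (0 < j)%N by apply: leq_trans le_J.
have le_4n : (4 * n ^ 2 <= 2 ^ k)%N.
  rewrite -(leq_exp2r _ _ J_gt0) -expnM; apply: leq_trans le_n.
  by rewrite expnMn -expnM mulnC leq_mul // leq_pexp2l // leq_addr.
have double_e : (('C((m + j), 2) - 'C(m, 2)) * 2 = j * (k + m - 2))%N.
  have tri a : ('C(a, 2) * 2 = a * a.-1)%N.
    by rewrite -[X in (_ * X)%N]/(2`!)%N bin_ffact ffactnSr ffactn1 subn1.
  rewrite mulnBl !tri; apply/eqP.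
  have -> : ((m + j) * (m + j).-1 = j * (k + m - 2) + m * m.-1)%N; last by rewrite addnK.
  rewrite def_k; case: (m) (j) j_gt0 => [|m'] [|j'] // _.
    by rewrite add0n addn0 addn0 subn2.
  have -> : ((m'.+1 + j'.+1).+1 + m'.+1 - 2 = 2 * m' + j' + 2)%N by lia.
  have -> : ((m'.+1 + j'.+1).-1 = m' + j' + 1)%N by lia.
  by rewrite /=; lia.
rewrite -(leq_exp2r _ _ (isT : 0 < 2)%N) -[X in (_ <= X)%N]expnM double_e
  (expnMn ('C(k, m) * 'C(n, j))) (expnMn 'C(k, m)).
have le_bin : ('C(n, j) ^ 2 <= n ^ (2 * j))%N.
  by rewrite mulnC expnM leq_exp2r // leq_bin_exp.
(* The hypothesis is the case [J]; each of the [j - J] further vertices contributes a factor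
   [4 * n ^ 2 <= 2 ^ k], so [n ^ (2 * h)] is gained once. *)
have le_nj : (n ^ (2 * j + 2 * h) * 4 ^ j <= 2 ^ (k * j))%N.
  have -> : (j = (j - J) + J)%N by rewrite subnK.
  have le1 : ((4 * n ^ 2) ^ (j - J) <= 2 ^ (k * (j - J)))%N.
    by rewrite expnM; case: (j - J)%N => // d; rewrite leq_exp2r.
  apply: (leq_trans (leq_trans _ (leq_mul le1 le_n))); last by rewrite -expnD -mulnDr.
  rewrite (expnMn 4) -[((n ^ 2) ^ _)%N]expnM [(n ^ (2 * J + 2 * h) * _)%N]mulnC.
  rewrite mulnACA -!expnD mulnC leq_mul // leq_pexp2l //; lia.
(* After multiplication by [2 ^ (2 * j)] the exponent is [j * m + k * j]: the first summand pays for
   ['C(k, m)], the second for ['C(n, j)] and [n ^ h]. *)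
rewrite -(@leq_pmul2r (2 ^ (2 * j))) ?expn_gt0 // -expnD.
have -> : (j * (k + m - 2) + 2 * j = j * m + k * j)%N.
  rewrite [(2 * j)%N]mulnC -mulnDr subnK; last by lia.
  by rewrite mulnDr addnC [(k * j)%N]mulnC.
rewrite [in X in (_ <= X)%N]expnD.
apply: (leq_trans _ (leq_mul (bin_sqr_leq k32 def_k j_gt0) le_nj)).
do 2!rewrite -[X in (X <= _)%N]mulnA; rewrite leq_mul //.
rewrite [X in (_ <= X * _)%N]expnD -[X in (_ <= X)%N]mulnA leq_mul //.
by rewrite -expnM [(h * 2)%N]mulnC [(2 ^ (2 * j))%N]expnM.
Qed.

Lemma card_bigcup_leq (I T : finType) (P : pred I) (F : I -> {set T}) :
  (#|(\bigcup_(i | P i) F i)%SET| <= \sum_(i | P i) #|F i|)%N.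
Proof.
elim/big_rec2: _ => [|i m A _ le_m]; first by rewrite cards0.
by apply: leq_trans (leq_card_setU _ _) _; rewrite leq_add2l.
Qed.

(** * Counting the graphs that acquire a clique far from a fixed planted set *)

Section Graphs.
Variable n : nat.
Implicit Types (G : graph n) (S K : {set 'I_n}) (F : {set {set 'I_n}}).

Lemma card_pairs_in S : #|pairs_in S| = 'C(#|S|, 2).
Proof.
rewrite -cards_draws; apply: eq_card => e.
by rewrite !inE andbC.
Qed.

Lemma pairs_inI S K : pairs_in S :&: pairs_in K = pairs_in (S :&: K).
Proof.
by apply/setP => e; rewrite !inE finset.subsetI; case: (#|e| == 2)%N; rewrite //= andbC.
Qed.

Lemma card_pairs_inD S K :
  #|pairs_in K :\: pairs_in S| = ('C(#|K|, 2) - 'C(#|K :&: S|, 2))%N.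
Proof. by rewrite cardsD pairs_inI !card_pairs_in. Qed.

Lemma clique_pairs G K : clique G K -> pairs_in K \subset edges G.
Proof.
move=> /'forall_implyP clK; apply/fintype.subsetP => e; rewrite !inE.
case/andP=> /cards2P[i [j [neq_ij def_e]]].
rewrite {}def_e finset.subUset !finset.sub1set => /andP[iK jK].
by have /'forall_implyP /(_ j jK) /implyP /(_ neq_ij) := clK i iK.
Qed.

Lemma plant_clique G S : clique (plant G S) S.
Proof.
apply/'forall_implyP => i iS; apply/'forall_implyP => j jS; apply/implyP => neq_ij.
by rewrite /adj !inE cards2 neq_ij finset.subUset !finset.sub1set iS jS orbT.
Qed.

Lemma clique_plant_pairs G S K :
  clique (plant G S) K -> pairs_in K :\: pairs_in S \subset edges G.
Proof. by move/clique_pairs; rewrite finset.subDset finset.setUC. Qed.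

Lemma card_graphs_containing F :
  F \subset pairs_in [set: 'I_n] ->
  (#|[set G : graph n | F \subset edges G]| <= 2 ^ ('C(n, 2) - #|F|))%N.
Proof.
move=> F_pairs.
have -> : ('C(n, 2) - #|F| = #|pairs_in [set: 'I_n] :\: F|)%N.
  by rewrite cardsD (finset.setIidPr F_pairs) card_pairs_in cardsT card_ord.
rewrite -card_powerset -(card_in_imset (f := fun G => edges G :\: F)).
  apply/subset_leq_card/fintype.subsetP => _ /imsetP[G _ ->].
  rewrite finset.powersetE finset.setSD //; apply/fintype.subsetP => e eG.
  by have /'forall_implyP /(_ e eG) := valP G; rewrite !inE finset.subsetT andbT.
move=> G H; rewrite !inE => FG FH eqGH; apply: val_inj.
rewrite -[LHS](finset.setID _ F) -[RHS](finset.setID _ F) -!/(edges _) eqGH.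
by rewrite (finset.setIidPr FG) (finset.setIidPr FH).
Qed.

Lemma card_sets_meeting S m j :
  (#|[set K : {set 'I_n} | (#|K :&: S| == m) && (#|K :\: S| == j)]| <=
   'C(#|S|, m) * 'C(n, j))%N.
Proof.
rewrite -cards_draws -[n in 'C(n, j)]card_ord -card_draws -cardsX.
rewrite -(card_in_imset (f := fun K => (K :&: S, K :\: S))).
  apply/subset_leq_card/fintype.subsetP => _ /imsetP[K + ->].
  by rewrite !inE finset.subsetIr.
by move=> K L _ _ [eqI eqD]; rewrite -(finset.setID K S) eqI eqD finset.setID.
Qed.

(** A property of the graph before planting: for fixed [S] that graph is uniform, so its probability
    is a plain count. *)
Definition far_clique S J G : bool :=
  [exists K : {set 'I_n}, [&& clique (plant G S) K, #|K|.+1 == #|S| & (J <= #|K :\: S|)%N]].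

(** Union bound over the number [j] of outside vertices and over [K]. The pairs of [K] not inside
    [S] must already be edges before planting; each of the at most [n] values of [j] then accounts
    for at most a fraction [n^(-h)] of all graphs. *)
Lemma card_far_clique S J h :
  (32 <= #|S|)%N -> (0 < J)%N ->
  (n ^ (2 * J + 2 * h) * 4 ^ J <= 2 ^ (#|S| * J))%N ->
  (#|[set G | far_clique S J G]| * n ^ h <= n * 2 ^ 'C(n, 2))%N.
Proof.
move=> S32 J_gt0 le_n; have le_Sn : (#|S| <= n)%N by rewrite -[n in (_ <= n)%N]card_ord max_card.
pose e j := ('C(#|S|.-1, 2) - 'C(#|S|.-1 - j, 2))%N.
have le_e j : (e j <= 'C(n, 2))%N.
  by apply: leq_trans (leq_subr _ _) (leq_bin2l _ _); apply: leq_trans (leq_pred _) _.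
pose fam (j : 'I_n) := [set K : {set 'I_n} |
  (#|K :&: S| == #|S|.-1 - j)%N && (#|K :\: S| == j)].
have sub : [set G | far_clique S J G] \subset
    (\bigcup_(j < n | (J <= j < #|S|)%N) \bigcup_(K in fam j)
      [set G : graph n | pairs_in K :\: pairs_in S \subset edges G])%SET.
  apply/fintype.subsetP => G; rewrite inE => /existsP[K /and3P[clK /eqP sizeK le_J]].
  have sizeD := cardsID S K.
  have lt_S : (#|K :\: S| < #|S|)%N by rewrite -sizeK ltnS -sizeD leq_addl.
  have lt_n := leq_trans lt_S le_Sn.
  apply/bigcupP; exists (Ordinal lt_n); first by rewrite /= le_J.
  apply/bigcupP; exists K; last by rewrite inE clique_plant_pairs.
  by rewrite inE /= -sizeK /= -sizeD addnK !eqxx.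
apply: (@leq_trans (\sum_(j < n | (J <= j < #|S|)%N)
    'C(#|S|, #|S|.-1 - j) * 'C(n, j) * 2 ^ ('C(n, 2) - e j) * n ^ h)).
  rewrite -big_distrl leq_mul // (leq_trans (subset_leq_card sub)) //.
  apply: (leq_trans (card_bigcup_leq _ _)); apply: leq_sum => j /andP[_ lt_j].
  apply: (leq_trans (card_bigcup_leq _ _)).
  apply: (@leq_trans (\sum_(K in fam j) 2 ^ ('C(n, 2) - e j))); last first.
    by rewrite sum_nat_const leq_mul // card_sets_meeting.
  apply: leq_sum => K; rewrite inE => /andP[/eqP sizeI /eqP sizeD].
  apply: leq_trans (card_graphs_containing _) _.
    by apply/fintype.subsetP => f; rewrite !inE => /and3P[_ -> _]; rewrite finset.subsetT.
  rewrite card_pairs_inD sizeI /e leq_exp2l // leq_sub2l //.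
  have := cardsID S K; rewrite sizeI sizeD => <-.
  by rewrite subnK //; lia.
apply: (@leq_trans (\sum_(j < n | (J <= j < #|S|)%N) 2 ^ 'C(n, 2))); last first.
  by rewrite big_mkcond -[n in (_ <= n * _)%N]card_ord -sum_nat_const; apply: leq_sum => j _; case: ifP.
apply: leq_sum => j /andP[le_J lt_j].
have def_k : #|S| = ((#|S|.-1 - j) + j).+1 by lia.
have le_j : (0 < J <= j)%N by rewrite J_gt0.
have := outside_cliques_leq S32 def_k le_j le_n.
rewrite subnK; last by lia.
rewrite -/(e j) => le_pow.
rewrite mulnAC -[X in (_ <= 2 ^ X)%N](subnKC (le_e j)) expnD leq_mul //.
Qed.

End Graphs.

(** * The reduction *)

Section Reduction.
Variable R : realType.
Implicit Types (A B : efficient_algorithm R).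

Lemma output_prob_ge0 A n (G : graph n) k Q : 0 <= output_prob A G k Q.
Proof.
rewrite /output_prob; case: (exec _ _ _ _ _) => // L.
by apply: sumr_ge0 => c _; apply: sqnorm_ge0.
Qed.

Lemma output_prob_mono A n (G : graph n) k (Q Q' : pred {set 'I_n}) :
  subpred Q Q' -> output_prob A G k Q <= output_prob A G k Q'.
Proof.
rewrite /output_prob => QQ'; case: (exec _ _ _ _ _) => // L.
rewrite big_mkcond [X in _ <= X]big_mkcond; apply: ler_sum => c _.
case: ifP => [/QQ' -> //|_]; by case: ifP => // _; apply: sqnorm_ge0.
Qed.

Lemma output_prob_le1 A n (G : graph n) k Q : output_prob A G k Q <= 1.
Proof.
apply: (le_trans (@output_prob_mono _ _ _ _ _ predT _)) => //.
rewrite /output_prob; case E: (exec _ _ _ _ _) => [L|]; last exact: ler01.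
by rewrite (run_sqnorm E) /= sqnorm_qinit.
Qed.

(** With [r = up_log 2 n], one mutation does what is wanted with probability at least
    [1 / (4 n)]. *)
Lemma exp_up_log_leq n : (0 < n)%N -> (2 ^ (up_log 2 n).+1 <= 4 * n)%N.
Proof.
case: n => [|[|n]] // _.
have /andP[+ _] := @up_log_bounds 2 n.+2 isT isT.
case: (up_log _ _) => [|r] //= lt_n; rewrite !expnS; lia.
Qed.

(** [B] is chosen before [S], so the bound can be applied to the planted clique, unknown to [B]. *)
Lemma exists_mutant A D : exists B, forall n (G : graph n) k (S : {set 'I_n}),
  (0 < n)%N -> (k <= n)%N ->
  output_prob A G k (fun K => #|symdiff K S| <= D)%N <=
    (4 * n)%:R ^+ D * output_prob B G k (pred1 S).
Proof.
have [d le_d] := mutant_time (degree A) D.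
have run_B n (G : graph n) k : (k <= n)%N ->
    exists L L', [/\ exec R (program A) (time_bound (degree A) n) G k = Some L,
      exec R (mutant (program A) D) (time_bound d n) G k = Some L' &
      forall S : {set 'I_n}, (0 < n)%N ->
      (2 ^- (up_log 2 n).+1) ^+ D *
        (\sum_(c <- L | (#|symdiff (output_set n c.1) S| <= D)%N) sqnorm c.2) <=
      \sum_(c <- L' | output_set n c.1 == S) sqnorm c.2].
  move=> le_k; have := halts_in_poly_time A G le_k.
  case E: (exec _ _ _ _ _) => [L|] // _.
  have [L' runL' leL'] := run_mutant D (up_logP n (isT : 1 < 2)%N) E.
  exists L, L'; split=> //; exact: run_leq (le_d n) runL'.
have halts n (G : graph n) k : (k <= n)%N ->
    isSome (exec R (mutant (program A) D) (time_bound d n) G k).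
  by move=> /(run_B n G)[L [L' [_ ->]]].
exists (EfficientAlgorithm halts) => n G k S n_gt0 le_k.
have [L [L' [runL runL' /(_ S n_gt0) le_S]]] := run_B n G k le_k.
rewrite /output_prob /= runL runL' mulrC -ler_pdivrMr ?exprn_gt0 ?ltr0n ?muln_gt0 //.
apply: le_trans le_S; rewrite mulrC ler_wpM2r ?sumr_ge0 // => [c _|].
  exact: sqnorm_ge0.
rewrite -[X in X <= _]exprVn; apply: lerXn2r; rewrite ?nnegrE ?invr_ge0 ?exprn_ge0 //.
rewrite lef_pV2 ?posrE ?ltr0n ?muln_gt0 ?exprn_gt0 //.
by rewrite -natrX ler_nat exp_up_log_leq.
Qed.

Lemma er_pmf_half n (G : graph n) : er_pmf (2^-1 : R) G = 2 ^- 'C(n, 2).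
Proof.
rewrite /er_pmf (eq_bigr (fun=> 2^-1)) => [|e _]; last by case: ifP => _; lra.
rewrite prodr_const exprVn; congr (_ ^- _).
by rewrite -[n in 'C(n, 2)]card_ord -card_draws; apply: eq_card => e; rewrite inE.
Qed.

Lemma success_probE A n k (Q : graph n -> pred {set 'I_n}) :
  success_prob A k Q = \sum_(S : {set 'I_n} | #|S| == k) \sum_(G : graph n)
    'C(n, k)%:R^-1 * 2 ^- 'C(n, 2) * output_prob A (plant G S) k (Q (plant G S)).
Proof.
rewrite /success_prob /planted_pmf.
under eq_bigr do rewrite mulr_suml.
rewrite exchange_big; apply: eq_bigr => S _ /=.
rewrite [RHS](partition_big (fun G => plant G S) predT) //=.
apply: eq_bigr => G _; rewrite mulr_suml; apply: eq_bigr => G0 /eqP <-.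
by rewrite er_pmf_half.
Qed.

(** If [K] has [j] vertices outside [S], it misses [j + 1] vertices of [S]. *)
Lemma card_symdiff (T : finType) (K S : {set T}) :
  #|K|.+1 = #|S| -> #|symdiff K S| = (#|K :\: S|.*2).+1.
Proof.
move=> sizeK; rewrite /symdiff cardsU.
have -> : (K :\: S) :&: (S :\: K) = finset.set0.
  by apply/setP => x; rewrite !inE; case: (x \in K); case: (x \in S).
rewrite cards0 subn0; have := cardsID S K; have := cardsID K S.
rewrite finset.setIC -sizeK; lia.
Qed.

(** For fixed [S] and unplanted graph, either a far clique exists and the success probability of [A]
    is bounded by 1, or every valid output of [A] lies within [2 * J] vertices of [S] and [B]
    recovers [S]. *)
Lemma success_prob_mutant A J h : (0 < J)%N ->
  exists B, forall n k, (32 <= k <= n)%N ->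
  (n ^ (2 * J + 2 * h) * 4 ^ J <= 2 ^ (k * J))%N ->
  success_prob A k (fun (G : graph n) K => simplex (clique_complex G) (k - 2) K) <=
    (4 * n)%:R ^+ (2 * J) *
      success_prob B k (fun (G : graph n) S => clique G S && (#|S| == k))
    + n%:R / n%:R ^+ h.
Proof.
move=> J_gt0; have [B le_B] := exists_mutant A (2 * J).
exists B => n k /andP[k32 le_k] le_n; have n_gt0 : (0 < n)%N by lia.
rewrite !success_probE mulr_sumr.
set w := 'C(n, k)%:R^-1 * 2 ^- 'C(n, 2) : R.
have w_ge0 : 0 <= w by rewrite mulr_ge0 // invr_ge0 ?exprn_ge0.
(* The error term is spread evenly over the ['C(n, k)] sets, so that both sides compare set by
   set. *)
have -> : n%:R / n%:R ^+ h =
    \sum_(S : {set 'I_n} | #|S| == k) 'C(n, k)%:R^-1 * (n%:R / n%:R ^+ h) :> R.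
  rewrite sumr_const (_ : #|_| = 'C(n, k)); last first.
    by rewrite -[n in 'C(n, k)]card_ord -card_draws; apply: eq_card => e; rewrite inE.
  by rewrite -mulrnAl -[_ *+ 'C(n, k)]mulr_natr mulVf ?mul1r // pnatr_eq0 -lt0n bin_gt0.
rewrite -big_split; apply: ler_sum => S /eqP sizeS /=.
apply: (@le_trans _ _ (\sum_(G : graph n) (w * ((4 * n)%:R ^+ (2 * J) *
    output_prob B (plant G S) k (fun K => clique (plant G S) K && (#|K| == k))) +
    w * (far_clique S J G)%:R))).
  apply: ler_sum => G _; rewrite -mulrDr ler_wpM2l //.
  have [farG|/existsPn no_far] := boolP (far_clique S J G).
    by rewrite (le_trans (output_prob_le1 _ _ _ _)) // lerDr mulr_ge0 ?output_prob_ge0 ?exprn_ge0.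
  rewrite addr0; apply: (@le_trans _ _
    (output_prob A (plant G S) k (fun K => #|symdiff K S| <= 2 * J)%N)).
    apply: output_prob_mono => K; rewrite /simplex inE => /andP[/andP[_ clK] /eqP sizeK].
    (* A [(k - 2)]-simplex has [(k - 2).+1] vertices, which is [k - 1] because [k >= 32]. *)
    have sizeKS : #|K|.+1 = #|S| by rewrite sizeK sizeS; lia.
    have := no_far K; rewrite clK sizeKS eqxx /= -ltnNge card_symdiff //.
    by rewrite mul2n ltn_double.
  apply: (le_trans (le_B _ _ _ S n_gt0 le_k)).
  rewrite ler_wpM2l ?exprn_ge0 //; apply: output_prob_mono => K /eqP ->.
  by rewrite plant_clique sizeS eqxx.
rewrite big_split lerD //=.
  by rewrite mulr_sumr; apply: ler_sum => G _; rewrite mulrCA.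
have -> : \sum_(G : graph n) w * (far_clique S J G)%:R =
    w * #|[set G | far_clique S J G]|%:R.
  rewrite -mulr_sumr -sum1_card natr_sum [in RHS]big_mkcond /=; congr (_ * _).
  by apply: eq_bigr => G _; rewrite inE; case: far_clique.
rewrite -mulrA ler_wpM2l ?invr_ge0 //.
rewrite -sizeS in k32 le_n; have := card_far_clique k32 J_gt0 le_n.
rewrite -(ler_nat R) !natrM !natrX => le_far.
by rewrite ler_pdivlMr ?exprn_gt0 ?ltr0n // -mulrA mulrC ler_pdivrMr ?exprn_gt0.
Qed.

End Reduction.

(** * Choice of the constants and conclusion *)

Section Asymptotics.
Variable R : realType.

(** Since [4 ^ J <= n], the left side is at most [n ^ (2 * J + 2 * h + 1)]; the slack [eps * J] in
    the exponent covers [2 * h + 1]. Also [log2 n >= 2 * J], whence [k >= 4 * J >= 32]. *)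
Lemma log2_threshold (eps : R) J h n k :
  (8 <= J)%N -> (2 * h + 1)%:R <= eps * J%:R -> (4 ^ J <= n)%N -> 0 < eps ->
  (2 + eps) * log2 n%:R <= k%:R ->
  (32 <= k)%N && (n ^ (2 * J + 2 * h) * 4 ^ J <= 2 ^ (k * J))%N.
Proof.
move=> J8 le_h le_J eps_gt0 le_k.
have n_gt0 : (0 < n)%N by rewrite (leq_trans _ le_J) ?expn_gt0.
have ln2_gt0 : 0 < ln 2 :> R by rewrite ln_gt0 // ltr1n.
have log_ge : (2 * J)%:R <= log2 (n%:R : R).
  rewrite ler_pdivlMr // mulr_natl -lnXn // ler_ln ?posrE ?exprn_gt0 ?ltr0n //.
  by rewrite -natrX ler_nat expnM.
have le_ln : (2 + eps) * ln n%:R <= k%:R * ln 2.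
  by move: le_k; rewrite /log2 mulrA ler_pdivrMr.
apply/andP; split.
  rewrite -(ler_nat R) (le_trans _ le_k) // (@le_trans _ _ (2 * (2 * J)%:R)) //.
    by rewrite -natrM ler_nat; lia.
  by rewrite ler_pM // lerDl ltW.
apply: (@leq_trans (n ^ (2 * J + 2 * h + 1))).
  by rewrite [X in (_ <= X)%N]expnD expn1 leq_mul.
rewrite -(ler_nat R) !natrX -ler_ln ?posrE ?exprn_gt0 ?ltr0n //.
rewrite !lnXn ?ltr0n // -[ln n%:R *+ _]mulr_natl -[ln 2 *+ _]mulr_natl.
rewrite [(k * J)%:R]natrM.
have ln_ge0 : 0 <= ln n%:R :> R by rewrite ln_ge0 // ler1n.
apply: (@le_trans _ _ (J%:R * ((2 + eps) * ln n%:R))); last first.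
  by rewrite [k%:R * _]mulrC -mulrA ler_wpM2l.
rewrite mulrA ler_wpM2r // -addnA natrD natrM mulrDr [2%:R * _]mulrC lerD2l.
by rewrite mulrC.
Qed.

End Asymptotics.

Local Open Scope classical_set_scope.
Local Open Scope ring_scope.

Theorem corollary1 (R : realType) (eps : R) (k : nat -> nat)
    (heps : 0 < eps < 2^-1)
    (hk : \forall n \near \oo,
       (2 + eps) * log2 n%:R <= (k n)%:R <= n%:R `^ (2^-1 - eps)) :
  strong_search_planted_clique_conjecture R ->
  forall delta : nat -> R, inverse_polynomial delta ->
  ~ exists A : efficient_algorithm R,
      \forall n \near \oo,
        delta n <= success_prob A (k n)
          (fun (G : graph n) S => simplex (clique_complex G) (k n - 2)%N S).
Proof.
move=> conj delta [c hdelta] [A hA].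
have /andP[eps_gt0 eps_lt] := heps.
(* The error [n / n^h] is then [n^(-(c+1))], one power below the assumed success probability. *)
pose h := (c + 2)%N.
(* The summand 7 ensures [J >= 8], hence [k >= 32]. *)
pose J := ((Num.truncn ((2 * h + 1)%:R / eps)).+1 + 7)%N.
have J_ge : (2 * h + 1)%:R <= eps * J%:R.
  rewrite mulrC -ler_pdivrMr // ltW // (lt_le_trans (truncnS_gt _)) //.
  by rewrite ler_nat leq_addr.
have [|B le_B] := @success_prob_mutant R A J h; first by rewrite addn_gt0.
(* The exponent is [4 * J + h] because [(4 n)^(2 J) <= n^(4 J)] once [n >= 4], which leaves [n^(-h)]
   after the loss. *)
have hB := conj eps eps (4 * J + h)%:R eps_gt0 heps (ltr0Sn _ _) B.
near \oo => n.
have n_big : (4 ^ J <= n)%N by near: n; exact: nbhs_infty_ge.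
have n_ge4 : (4 <= n)%N by apply: leq_trans n_big; rewrite -[X in (X <= _)%N]expn1 leq_pexp2l.
have n_gt0 : 0 < n%:R :> R by rewrite ltr0n; lia.
have hkn : (2 + eps) * log2 n%:R <= (k n)%:R <= n%:R `^ (2^-1 - eps) by near: n.
have /andP[k_ge k_le] := hkn.
have /andP[k32 le_n] := @log2_threshold R eps J h n (k n) (leq_addl _ 7) J_ge n_big eps_gt0 k_ge.
have le_kn : (k n <= n)%N.
  rewrite -(ler_nat R) (le_trans k_le) // -[leRHS]powRr1 ?ler0n //.
  by rewrite ler_powR ?ler1n; [lra|lia|lra].
have := le_B n (k n); rewrite k32 le_kn => /(_ isT le_n) le_A.
have le_Bn : success_prob B (k n)
    (fun (G : graph n) S => clique G S && (#|S| == k n)) <= n%:R ^- (4 * J + h).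
  (* The conjecture is uniform in the clique size, so [k n] is generalized before the eventual
     statement is used. *)
  by rewrite -powR_mulrn ?ler0n // -powRN; move: (k n) hkn; near: n.
have le_d : n%:R ^- c <= delta n by near: n.
have le_dA : delta n <= success_prob A (k n)
  (fun (G : graph n) S => simplex (clique_complex G) (k n - 2)%N S) by near: n.
have le_pow : (4 * n)%:R ^+ (2 * J) * n%:R ^- (4 * J + h) <= n%:R ^- h :> R.
  rewrite exprD invfM mulrA ler_piMl ?invr_ge0 ?exprn_ge0 ?ler0n //.
  rewrite ler_pdivrMr ?exprn_gt0 // mul1r -!natrX ler_nat.
  have -> : (4 * J = 2 * (2 * J))%N by rewrite mulnA.
  by rewrite (expnM n) leq_exp2r ?muln_gt0 ?addn_gt0 // -mulnn leq_mul.
have : n%:R ^- c <= n%:R ^- h + n%:R / n%:R ^+ h :> R.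
  apply: le_trans le_d (le_trans le_dA (le_trans le_A _)); rewrite lerD2r.
  by apply: le_trans le_pow; rewrite ler_wpM2l ?exprn_ge0 ?ler0n.
(* Over the common denominator [n^h] the inequality reads [n^2 <= 1 + n], which is false for
   [n >= 4]. *)
have -> : n%:R ^- c = n%:R ^+ 2 / n%:R ^+ h :> R.
  by rewrite /h exprD invfM mulrCA mulfV ?mulr1 // expf_neq0 // gt_eqF.
rewrite -[X in X + _]mul1r -mulrDl ler_pM2r ?invr_gt0 ?exprn_gt0 //.
apply/negP; rewrite -ltNge.
have : 4%:R <= n%:R :> R by rewrite ler_nat.
nra.
Unshelve. all: by end_near.
Qed.
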